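(* Let $X$ be a compact Hausdorff space, let $\gamma=\{\gamma_1,\ldots,\gamma_N\}$ be an iterated function system on $X$, and let $\mathbb{X}\subseteq X$ be a subset. Assume: (i) $\mathbb{X}$ is dense in $X$ and completely invariant under $\gamma$; (ii) the images $\gamma_1(\mathbb{X}),\ldots,\gamma_N(\mathbb{X})$ are pairwise disjoint; (iii) the restriction $\gamma_k|_{\mathbb{X}}$ is injective for all $k=1,\ldots,N$; (iv) the maps $\gamma_1,\ldots,\gamma_N$ are (topological) embeddings; (v) there is a dense open set $U$ in $X$ such that the images $\gamma_1(U),\ldots,\gamma_N(U)$ are pairwise disjoint open sets in $X$ contained in $U$, and $\mathbb{X}\subseteq U$; (vi) $\mathbb{X}$ is comeager in $X$. Let $\hat\rho=(\hat\rho_A,\hat\rho_E)$, $C^*(\hat\rho)$ and $\hat D\subseteq C^*(\hat\rho)$ be as constructed in the context. If $\gamma$ is not essentially free, then $\hat\rho_A(A)$ is properly contained in $\hat D$ and hence is not a masa of $C^*(\hat\rho)$.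
   Context: An iterated function system on $X$ is a finite family $\gamma=\{\gamma_1,\ldots,\gamma_N\}$ (repetitions allowed) of continuous maps $X\to X$. Put $I=\{1,\ldots,N\}$. For $\boldsymbol k=(k_n,\ldots,k_1)\in I^n$ put $\gamma_{\boldsymbol k}=\gamma_{k_n}\circ\cdots\circ\gamma_{k_1}$ (the identity if $n=0$). For $S\subseteq X$ put $\gamma(S)=\bigcup_{k}\gamma_k(S)$, $\gamma^0(S)=S$, $\gamma^{n+1}(S)=\gamma(\gamma^n(S))$. $S$ is completely invariant under $\gamma$ if $\gamma_k(S)\subseteq S$ and $\gamma_k^{-1}(S)\subseteq S$ for all $k$. $\gamma$ is essentially free if $\{x\in X:\gamma_{\boldsymbol k}(x)=\gamma_{\boldsymbol l}(x)\}$ is nowhere dense for all finite index sequences $\boldsymbol k\neq\boldsymbol l$ (of possibly different lengths, possibly empty). Let $M_{\mathbb{X}}$ be the C*-algebra of bounded operators on $\ell^2(\mathbb{X})$ (orthonormal basis $(e_x)_{x\in\mathbb{X}}$, inner products linear in the second variable) and $D_{\mathbb{X}}\subseteq M_{\mathbb{X}}$ the set of diagonal operators, i.e. those $\alpha$ with $\langle e_x|\alpha e_y\rangle=0$ for $x\ne y$. Let $G=\bigcup_{k}\{(\gamma_k(y),y):y\in X\}\subseteq X\times X$ be the graph of $\gamma$, $A=C(X)$, $E=C(G)$. Define $\rho_A:A\to M_{\mathbb{X}}$ and $\rho_E:E\to M_{\mathbb{X}}$ by $\rho_A(a)e_x=a(x)e_x$ and $\rho_E(f)e_y=\sum_{k=1}^N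 f(\gamma_k(y),y)\,e_{\gamma_k(y)}$. Let $\upsilon_n$ $(n\in\mathbb{Z})$ be the unitary $e_k\mapsto e_{n+k}$ on $\ell^2(\mathbb{Z})$ and $C^*(\mathbb{Z})$ the C*-algebra generated by the $\upsilon_n$. Define $\hat\rho_A(a)=\rho_A(a)\otimes\upsilon_0$, $\hat\rho_E(f)=\rho_E(f)\otimes\upsilon_1$ in $M_{\mathbb{X}}\otimes C^*(\mathbb{Z})$, and let $C^*(\hat\rho)$ be the C*-subalgebra generated by $\hat\rho_A(A)\cup\hat\rho_E(E)$. For $n\in\mathbb{N}_0$ a $\gamma$-chain of length $n$ is a tuple $(x_n,\ldots,x_0)\in X^{n+1}$ such that for each $i$ there is $k\in I$ with $x_i=\gamma_k(x_{i-1})$; for $\boldsymbol k=(k_n,\ldots,k_1)\in I^n$ and $x\in X$ let $\boldsymbol\gamma_{\boldsymbol k}(x)=(\gamma_{k_n,\ldots,k_1}(x),\ldots,\gamma_{k_1}(x),x)$. Let $X_{m,n}$ be the compact space of pairs $(\boldsymbol x,\boldsymbol y)$ of $\gamma$-chains of lengths $m$ and $n$ with the same last entry $x_0=y_0$. Define a linear map $\rho_{m,n}:C(X_{m,n})\to M_{\mathbb{X}}$ as follows: for $y\in\gamma^n(\mathbb{X})$ there are unique $\boldsymbol k\in I^n$, $x\in\mathbb{X}$ with $y=\gamma_{\boldsymbol k}(x)$, and $\rho_{m,n}(f)e_y=\sum_{\boldsymbol j\in I^m}f(\boldsymbol\gamma_{\boldsymbol j}(x),\boldsymbol\gamma_{\boldsymbol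 k}(x))\,e_{\gamma_{\boldsymbol j}(x)}$; for $y\in\mathbb{X}\setminus\gamma^n(\mathbb{X})$, $\rho_{m,n}(f)e_y=0$. Let $E_{m,n}$ be the range of $\rho_{m,n}$. For $k\in\mathbb{Z}$ let $B_k$ be the norm-closed linear span of $\bigcup_{m-n=k}E_{m,n}$ ($m,n\in\mathbb{N}_0$), and $D_k=B_k\cap D_{\mathbb{X}}$. Let $\hat D=\bigoplus_{k\in\mathbb{Z}}D_k\otimes\upsilon_k$, meaning the norm-closed linear span of the subspaces $D_k\otimes\upsilon_k=\{\alpha\otimes\upsilon_k:\alpha\in D_k\}$; it is a closed commutative $*$-subalgebra of $C^*(\hat\rho)$ containing $\hat\rho_A(A)$. A masa is a maximal commutative $*$-subalgebra. *)

(* Defs.v *)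
From HB Require Import structures.
From mathcomp Require Import all_boot all_order all_algebra.
From mathcomp Require Import all_classical all_reals all_analysis.
From mathcomp Require Import complex ring lra.

Set Implicit Arguments.
Unset Strict Implicit.
Unset Printing Implicit Defensive.
Import Order.TTheory GRing.Theory Num.Theory.
Import numFieldNormedType.Exports.

Local Open Scope classical_set_scope.
Local Open Scope ring_scope.

(* Naming the complex numbers at type numClosedFieldType gives them the
   topology of the modulus; the bare carrier R[i] has no canonical topology. *)
Definition Cx (R : realType) : numClosedFieldType := R[i].

Definition sqmod (R : realType) (z : Cx R) : R :=
  complex.Re z ^+ 2 + complex.Im z ^+ 2.

Section SquareSummable.
Context {R : realType}.
Implicit Types (I J : choiceType).

Lemma sqmod_ge0 (z : Cx R) : 0 <= sqmod z.
Proof. by rewrite addr_ge0// sqr_ge0. Qed.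

Lemma sqmod0 : sqmod (0 : Cx R) = 0.
Proof. by rewrite /sqmod /= expr0n addr0. Qed.

Lemma sqmod1 : sqmod (1 : Cx R) = 1.
Proof. by rewrite /sqmod /= expr0n expr1n addr0. Qed.

Lemma sqmodM (a z : Cx R) : sqmod (a * z) = sqmod a * sqmod z.
Proof. by case: a => a b; case: z => x y; rewrite /sqmod /=; ring. Qed.

Lemma sqmodD (a b : Cx R) : sqmod (a + b) <= 2 * (sqmod a + sqmod b).
Proof.
case: a => a b'; case: b => x y; rewrite /sqmod /=.
rewrite -subr_ge0 [leRHS](_ : _ = (a - x) ^+ 2 + (b' - y) ^+ 2); last by ring.
by rewrite addr_ge0// sqr_ge0.
Qed.

Definition sqsum I (f : I -> Cx R) : \bar R :=
  \esum_(i in [set: I]) (sqmod (f i))%:E.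

Lemma sqsum_ge0 I (f : I -> Cx R) : (0 <= sqsum f)%E.
Proof. by apply: esum_ge0 => i _; rewrite lee_fin sqmod_ge0. Qed.

Lemma esumZ_le I (D : set I) (c : R) (u : I -> \bar R) : 0 <= c ->
  (forall i, 0 <= u i)%E ->
  (\esum_(i in D) (c%:E * u i) <= c%:E * \esum_(i in D) u i)%E.
Proof.
move=> c0 u0; apply: ge_ereal_sup => _ [F [finF FD] <-].
rewrite -ge0_mule_fsumr//; apply: lee_wpmul2l; first by rewrite lee_fin.
by apply: esum_ge; exists F.
Qed.

Lemma sqsumZ I (a : Cx R) (f : I -> Cx R) :
  (sqsum (a \*: f)%R <= (sqmod a)%:E * sqsum f)%E.
Proof.
rewrite /sqsum; under eq_esum do rewrite /= sqmodM EFinM.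
apply: esumZ_le => [|i]; first exact: sqmod_ge0.
by rewrite lee_fin sqmod_ge0.
Qed.

Lemma sqsumD I (f g : I -> Cx R) :
  (sqsum (f \+ g)%R <= 2%:E * (sqsum f + sqsum g))%E.
Proof.
have s0 h (i : I) : (0 <= (sqmod (h i : Cx R))%:E)%E by rewrite lee_fin sqmod_ge0.
have -> : (sqsum f + sqsum g =
    \esum_(i in [set: I]) ((sqmod (f i))%:E + (sqmod (g i))%:E))%E.
  by rewrite esumD.
apply: le_trans (esumZ_le _ _ _) => // [|i]; last by rewrite adde_ge0.
by apply: le_esum => i _; rewrite /= -EFinD -EFinM lee_fin sqmodD.
Qed.

Definition l2_pred I : {pred I -> Cx R} := [pred f | (sqsum f < +oo)%E].

Lemma l2_submod_closed I : submod_closed (@l2_pred I).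
Proof.
split=> [|a f g].
  rewrite inE /sqsum esum1// => i _.
  by rewrite [X in sqmod X](_ : _ = 0) ?sqmod0.
rewrite !inE => fl gl; apply: le_lt_trans (sqsumD _ _) _.
rewrite lte_mul_pinfty// lte_add_pinfty//.
apply: le_lt_trans (sqsumZ _ _) _.
by rewrite lte_mul_pinfty// lee_fin sqmod_ge0.
Qed.

HB.instance Definition _ I := GRing.isSubmodClosed.Build _ _ (@l2_pred I)
  (@l2_submod_closed I).

End SquareSummable.

Record l2 (R : realType) (I : choiceType) := L2 {
  l2_fun :> I -> Cx R;
  _ : l2_fun \in @l2_pred R I }.

Section L2.
Context {R : realType} {I : choiceType}.

HB.instance Definition _ := [isSub for @l2_fun R I].
HB.instance Definition _ := [Choice of l2 R I by <:].
HB.instance Definition _ := [SubChoice_isSubLmodule of l2 R I by <:].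

Implicit Types f g : l2 R I.

Lemma l2P f g : (forall i, f i = g i) -> f = g.
Proof. by move=> fg; apply: val_inj; apply: funext. Qed.

Lemma l2_addE f g i : (f + g) i = f i + g i. Proof. by []. Qed.
Lemma l2_scaleE a f i : (a *: f) i = a * f i. Proof. by []. Qed.
Lemma l2_0E i : (0 : l2 R I) i = 0. Proof. by []. Qed.

Lemma sqsum_lty f : (sqsum f < +oo)%E. Proof. by case: f. Qed.

Lemma sqsum_fin f : sqsum f \is a fin_num.
Proof. by rewrite ge0_fin_numE ?sqsum_ge0 ?sqsum_lty. Qed.

Definition l2norm f : R := Num.sqrt (fine (sqsum f)).

(* Unordered sums: the difference of the sums of the positive and negative
   parts, for the real and imaginary parts of the terms. *)
Definition rsum (u : I -> R) : R :=
  fine (\esum_(i in [set: I]) (Num.max (u i) 0)%:E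
        - \esum_(i in [set: I]) (Num.max (- u i) 0)%:E)%E.

Definition csum (u : I -> Cx R) : Cx R :=
  Complex (rsum (fun i => complex.Re (u i))) (rsum (fun i => complex.Im (u i))).

Definition dot f g : Cx R := csum (fun i => (f i)^* * g i).

Lemma basis_subproof i : (fun j => (j == i)%:R : Cx R) \in @l2_pred R I.
Proof.
rewrite inE /sqsum [ltLHS](_ : _ = \esum_(j in [set i]) 1%:E)%E.
  by rewrite esum_set1 ?lte0 ?ltry.
rewrite [RHS]esum_mkcond; apply: eq_esum => j _.
have -> : (j \in [set i]) = (j == i) by apply/idP/eqP; rewrite inE.
by case: eqP => _; rewrite ?sqmod0 ?sqmod1.
Qed.

Definition basis i : l2 R I := L2 (basis_subproof i).

Lemma dot_basis i f : dot (basis i) f = f i.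
Proof.
have rsum1 (u : I -> R) : (forall j, j != i -> u j = 0) -> rsum u = u i.
  move=> u0; have E (v : I -> R) : (forall j, j != i -> v j = 0) ->
      (\esum_(j in [set: I]) (Num.max (v j) 0)%:E)%E = (Num.max (v i) 0)%:E.
    move=> v0; transitivity (\esum_(j in [set i]) (Num.max (v j) 0)%:E)%E.
      rewrite [RHS]esum_mkcond; apply: eq_esum => j _; case: ifPn => //.
      rewrite notin_setE => /eqP ji; by rewrite v0// maxxx.
    by rewrite esum_set1// lee_fin le_max lexx orbT.
  rewrite /rsum (E u)// (E (fun j => - u j)) => [|j /u0 ->]; last exact: oppr0.
  by rewrite -EFinB /= !maxEle oppr_le0; case: (leP (u i) 0); case: (leP 0 (u i)) => //; lra.
rewrite /dot /csum !rsum1 => [|j /negbTE ji|j /negbTE ji] /=; rewrite ?ji ?eqxx.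
- by rewrite conjC1 mul1r; case: (f i).
- by rewrite conjC0 mul0r.
- by rewrite conjC0 mul0r.
Qed.

End L2.

Section BoundedOperators.
Context {R : realType} {I : choiceType}.
Implicit Types S T : l2 R I -> l2 R I.

Definition bounded_op_pred : {pred l2 R I -> l2 R I} :=
  [pred T | `[< linear T /\
                exists M : R, forall f, l2norm (T f) <= M * l2norm f >]].

Lemma bounded_opP T : linear T ->
  (exists2 M : R, 0 <= M & forall f, (sqsum (T f) <= M%:E * sqsum f)%E) <->
  (exists M : R, forall f, l2norm (T f) <= M * l2norm f).
Proof.
move=> lT; split=> [[M M0 TM]|[M TM]].
  exists (Num.sqrt M) => f; rewrite -sqrtrM// ler_wsqrtr//.
  by rewrite -lee_fin EFinM !fineK ?sqsum_fin.
exists (M ^+ 2) => [|f]; first exact: sqr_ge0.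
rewrite -(fineK (sqsum_fin f)) -(fineK (sqsum_fin (T f))) -EFinM lee_fin.
have s0 (g : l2 R I) : 0 <= fine (sqsum g) by rewrite fine_ge0// sqsum_ge0.
rewrite -[leLHS]sqr_sqrtr// -[fine (sqsum f)]sqr_sqrtr// -exprMn.
rewrite ler_sqr ?nnegrE ?sqrtr_ge0//; first exact: TM.
by apply: le_trans (TM f); rewrite sqrtr_ge0.
Qed.

Lemma bounded_op_submod_closed : submod_closed bounded_op_pred.
Proof.
split=> [|a S T].
  have l0 : linear (0 : l2 R I -> l2 R I).
    by move=> a f g; apply/esym/(etrans (addr0 _)); exact: scaler0.
  rewrite inE; split; first exact: l0.
  apply/(bounded_opP l0); exists 0 => // f; rewrite mul0e /sqsum esum1// => i _.
  by rewrite l2_0E sqmod0.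
rewrite !inE => -[lS /bounded_opP-/(_ lS)[M M0 SM]].
move=> -[lT /bounded_opP-/(_ lT)[M' M0' TM]].
have lST : linear (a *: S + T).
  move=> b f g; apply: l2P => i.
  rewrite [LHS](_ : _ = a * S (b *: f + g) i + T (b *: f + g) i)//.
  rewrite [RHS](_ : _ = b * (a * S f i + T f i) + (a * S g i + T g i))//.
  by rewrite lS lT !l2_addE !l2_scaleE; ring.
split; first exact: lST.
apply/(bounded_opP lST); exists (2 * (sqmod a * M + M')) => [|f].
  by rewrite mulr_ge0// addr_ge0// mulr_ge0// sqmod_ge0.
have -> : sqsum ((a *: S + T) f) = sqsum ((a \*: (S f : I -> Cx R)) \+ T f) by [].
have H1 : (sqsum (a \*: (S f : I -> Cx R))%R <= (sqmod a * M)%:E * sqsum f)%E.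
  apply: le_trans (sqsumZ _ _) _; rewrite EFinM -muleA.
  by apply: lee_wpmul2l (SM f); rewrite lee_fin sqmod_ge0.
apply: le_trans (sqsumD _ _) _; rewrite EFinM -muleA; apply: lee_wpmul2l => //.
rewrite EFinD ge0_muleDl ?lee_fin ?mulr_ge0 ?sqmod_ge0//.
exact: leeD H1 (TM f).
Qed.

HB.instance Definition _ := GRing.isSubmodClosed.Build _ _ bounded_op_pred
  bounded_op_submod_closed.
End BoundedOperators.

Record bop (R : realType) (I : choiceType) := Bop {
  bop_fun :> l2 R I -> l2 R I;
  _ : bop_fun \in bounded_op_pred }.

Section Bop.
Context {R : realType} {I : choiceType}.

HB.instance Definition _ := [isSub for @bop_fun R I].
HB.instance Definition _ := [Choice of bop R I by <:].
HB.instance Definition _ := [SubChoice_isSubLmodule of bop R I by <:].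

Implicit Types S T : bop R I.

Lemma bop_linear T : linear T.
Proof. by case: T => T /=; rewrite inE => -[]. Qed.

HB.instance Definition _ T := GRing.isLinear.Build _ _ _ _ T (bop_linear T).

Lemma bop_bounded T :
  exists2 M : R, 0 <= M & forall f, (sqsum (T f) <= M%:E * sqsum f)%E.
Proof.
by apply/(bounded_opP (bop_linear T)); case: T => T /=; rewrite inE => -[].
Qed.

Lemma bop_ext S T : (forall i, S (basis i) = T (basis i)) -> S = T.
Proof.
move=> ST; apply/val_inj/funext => f /=.
suff D0 (D : bop R I) : (forall i, D (basis i) = 0) -> D f = 0.
  apply: subr0_eq; apply: (D0 (S - T)) => i.
  by rewrite [LHS](_ : _ = S (basis i) - T (basis i))// ST subrr.
move=> Db; have [M M0 DM] := bop_bounded D.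
have small (e : R) : 0 < e -> (sqsum (D f) <= (M * e)%:E)%E.
  move=> e0; have [_ [F [finF _] <-] eF] :=
    ub_ereal_sup_adherent e0 (sqsum_fin f : ereal_sup _ \is a fin_num).
  have [s sF] := (finite_seqP F).1 finF.
  have memF i : (i \in F) = (i \in undup s).
    by rewrite mem_undup sF; apply/idP/idP; rewrite inE.
  pose p : l2 R I := \sum_(i <- undup s) f i *: basis i.
  have pE i : p i = if i \in F then f i else 0.
    have -> : p i = \sum_(j <- undup s) f j * (i == j)%:R.
      by rewrite /p; elim/big_rec2: _ => //= j a b _ <-.
    rewrite memF; case: ifPn => iF.
      rewrite (bigD1_seq i) ?undup_uniq//= eqxx mulr1 big1 ?addr0//.
      by move=> j /negbTE ji; rewrite eq_sym ji mulr0.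
    rewrite big_seq big1// => j jF; rewrite [i == j]negbTE ?mulr0//.
    by apply: contra iF => /eqP ->.
  have Dp : D p = 0.
    by rewrite linear_sum big1// => i _; rewrite linearZ /= Db scaler0.
  have -> : D f = D (f - p) by rewrite linearB /= Dp subr0.
  apply: le_trans (DM _) _; rewrite EFinM lee_wpmul2l//.
  pose q := f - p.
  have fS : sqsum f = (\sum_(i \in F) (sqmod (f i))%:E + sqsum q)%E.
    rewrite /sqsum (esumID F) => [|i _]; last by rewrite lee_fin sqmod_ge0.
    rewrite setTI setTI esum_fset// => [|i _]; last by rewrite lee_fin sqmod_ge0.
    congr (_ + _)%E; rewrite [LHS]esum_mkcond; apply: eq_esum => i _.
    have -> : q i = f i - p i by [].
    rewrite pE in_setC; case: (i \in F) => /=; first by rewrite subrr sqmod0.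
    by rewrite subr0.
  have : (sqsum f - e%:E < \sum_(i \in F) (sqmod (f i))%:E)%E by exact: eF.
  rewrite fS.
  rewrite -/q; have : sqsum q \is a fin_num := sqsum_fin _.
  rewrite fsumEFin//; case: (sqsum q) => // r _.
  by rewrite -!EFinD lte_fin lee_fin; lra.
apply: l2P => i; rewrite l2_0E.
have : sqmod (D f i) <= 0.
  apply/ler_addgt0Pr => e e0; rewrite add0r.
  have M1 : 0 < M + 1 by rewrite ltr_wpDl.
  have Me : M * (e / (M + 1)) <= e.
    by rewrite mulrCA ger_pMr// ler_pdivrMr// mul1r lerDl.
  rewrite -lee_fin; apply: le_trans (le_trans (small _ (divr_gt0 e0 M1)) _); last first.
    by rewrite lee_fin.
  by apply: esum_ge; exists [set i]; rewrite ?fsbig_set1//; split.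
have := sqmod_ge0 (D f i); case: (D f i) => x y; rewrite /sqmod /= => _ xy.
have x0 : x ^+ 2 <= 0 by apply: le_trans xy; rewrite lerDl sqr_ge0.
have y0 : y ^+ 2 <= 0 by apply: le_trans xy; rewrite lerDr sqr_ge0.
have sq0 (u : R) : u ^+ 2 <= 0 -> u = 0.
  by move=> u0; apply/eqP; rewrite -sqrf_eq0 eq_le u0 sqr_ge0.
by rewrite (sq0 x x0) (sq0 y y0).
Qed.

Lemma bop_sumE J (r : seq J) (P : pred J) (F : J -> bop R I) f :
  (\sum_(j <- r | P j) F j) f = \sum_(j <- r | P j) F j f.
Proof. by elim/big_rec2: _ => //= j a b _ <-. Qed.

Lemma mk_bop_subproof (T : l2 R I -> l2 R I) : linear T ->
  (exists2 M : R, 0 <= M & forall f, (sqsum (T f) <= M%:E * sqsum f)%E) ->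
  T \in bounded_op_pred.
Proof. by move=> lT bT; rewrite inE; split=> //; apply/bounded_opP. Qed.

Lemma comp_subproof S T : S \o T \in bounded_op_pred.
Proof.
apply: mk_bop_subproof => [a f g|]; first by rewrite /= !linearP.
have [M M0 SM] := bop_bounded S; have [M' M0' TM] := bop_bounded T.
exists (M * M') => [|f]; first exact: mulr_ge0.
apply: le_trans (SM _) _; rewrite EFinM -muleA.
by rewrite lee_wpmul2l.
Qed.

Definition bop_comp S T : bop R I := Bop (comp_subproof S T).

Definition opnorm T : R := sup [set l2norm (T f) | f in [set f | l2norm f <= 1]].

Definition is_adjoint T T' := forall f g, dot f (T' g) = dot (T f) g.

Definition norm_closure (A : set (bop R I)) : set (bop R I) :=
  [set T | forall e : R, 0 < e -> exists2 S, A S & opnorm (T - S) < e].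

Definition lin_span (A : set (bop R I)) : set (bop R I) :=
  [set T | exists n (c : 'I_n -> Cx R) (S : 'I_n -> bop R I),
     (forall i, A (S i)) /\ T = \sum_(i < n) c i *: S i].

Definition is_star_subalgebra (A : set (bop R I)) :=
  [/\ A 0,
      forall (a : Cx R) S T, A S -> A T -> A (a *: S + T),
      forall S T, A S -> A T -> A (bop_comp S T)
    & forall T T', A T -> is_adjoint T T' -> A T'].

Definition is_cstar_subalgebra (A : set (bop R I)) :=
  is_star_subalgebra A /\ norm_closure A `<=` A.

Definition cstar_generated (A : set (bop R I)) : set (bop R I) :=
  smallest is_cstar_subalgebra A.

Definition is_commutative (A : set (bop R I)) :=
  forall S T, A S -> A T -> bop_comp S T = bop_comp T S.

Definition is_masa (B A : set (bop R I)) :=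
  [/\ is_star_subalgebra A, is_commutative A, A `<=` B
    & forall A', is_star_subalgebra A' -> is_commutative A' -> A' `<=` B ->
        A `<=` A' -> A' = A].

Definition diagonal_ops : set (bop R I) :=
  [set T : bop R I | forall x y, x <> y -> dot (basis x) (T (basis y)) = 0].

End Bop.

(* Several operators below are specified by their values on the basis vectors,
   which determine a bounded operator by bop_ext; this lemma is the source of
   their existence. *)
Lemma weighted_injection (R : realType) (J I : choiceType) (a b : J -> I)
    (w : J -> Cx R) (M : R) :
  injective a -> injective b -> 0 <= M -> (forall x, sqmod (w x) <= M) ->
  exists T : bop R I, (forall x, T (basis (a x)) = w x *: basis (b x)) /\
    forall i, ~ range a i -> T (basis i) = 0.
Proof.
move=> ia ib M0 wM.
pose bi z : option J := xget None [set o | exists2 x, o = Some x & b x = z].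
have biK x : bi (b x) = Some x.
  apply: xget_unique; first by exists x.
  by move=> _ [y -> /ib ->].
have biN z : ~ range b z -> bi z = None.
  by move=> Nz; rewrite /bi xgetPN// => o [x _ xz]; apply: Nz; exists x.
pose F (f : l2 R I) z : Cx R := if bi z is Some x then w x * f (a x) else 0.
have FM f : (sqsum (F f) <= M%:E * sqsum f)%E.
  rewrite [leLHS](_ : _ = \esum_(z in range b) (sqmod (F f z))%:E)%E; last first.
    rewrite [RHS]esum_mkcond; apply: eq_esum => z _.
    case: ifPn => // /negP; rewrite inE => /biN.
    by rewrite /F => ->; rewrite sqmod0.
  rewrite esum_image; last by move=> x y _ _ /ib.
  apply: (@le_trans _ _
    (\esum_(x in [set: J]) (M%:E * (sqmod (f (a x)))%:E))%E).
    apply: le_esum => x _; rewrite /F biK sqmodM EFinM.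
    by rewrite lee_wpmul2r ?lee_fin ?sqmod_ge0.
  apply: le_trans (esumZ_le _ _ _) _ => [//|x|].
    by rewrite lee_fin sqmod_ge0.
  apply: lee_wpmul2l => //.
  rewrite -(@esum_image _ _ _ [set: J] a (fun i => (sqmod (f i))%:E)); last first.
    by move=> x y _ _ /ia.
  rewrite esum_mkcond; apply: le_esum => i _.
  by case: ifPn => // _; rewrite lee_fin sqmod_ge0.
have Fl2 f : F f \in @l2_pred R I.
  by rewrite inE; apply: le_lt_trans (FM f) _; rewrite lte_mul_pinfty ?sqsum_lty.
have lF : linear (fun f => L2 (Fl2 f)).
  move=> c f h; apply: l2P => z; rewrite l2_addE l2_scaleE /= /F.
  case: (bi z) => [x|]; last by rewrite mulr0 addr0.
  by rewrite l2_addE l2_scaleE; ring.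
have bF : (fun f => L2 (Fl2 f)) \in bounded_op_pred.
  by apply: mk_bop_subproof => //; exists M.
exists (Bop bF); split=> [x|i Ni]; apply: l2P => z; rewrite ?l2_scaleE /= /F.
  have [[y _ <-]|Nz] := pselect (range b z).
    rewrite biK /= (inj_eq ia) (inj_eq ib).
    by case: eqP => [->|_]; rewrite ?mulr0.
  rewrite biN// [z == b x]negbTE ?mulr0//.
  by apply/eqP => zb; apply: Nz; exists x.
case: (bi z) => // x /=; rewrite [a x == i]negbTE ?mulr0//.
by apply/eqP => ai; apply: Ni; exists x.
Qed.

Section Tensor.
Context {R : realType} {I J : choiceType}.
Implicit Types (f : l2 R (I * J)%type) (S : bop R I) (T : bop R J).

Lemma esum_pair (u : I * J -> \bar R) : (forall p, 0 <= u p)%E ->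
  (\esum_(p in [set: I * J]) u p =
   \esum_(i in [set: I]) \esum_(j in [set: J]) u (i, j))%E.
Proof.
move=> u0; rewrite (@esum_esum _ _ _ _ _ (fun i j => u (i, j)))//.
rewrite [X in _ = esum X _](_ : _ = [set: I * J]); last by apply/seteqP; split.
by apply: eq_esum => -[].
Qed.

Lemma esum_pair_swap (u : I * J -> \bar R) : (forall p, 0 <= u p)%E ->
  (\esum_(p in [set: I * J]) u p =
   \esum_(j in [set: J]) \esum_(i in [set: I]) u (i, j))%E.
Proof.
move=> u0; rewrite (@esum_esum _ _ _ _ _ (fun j i => u (i, j)))//.
rewrite [X in _ = esum X _](_ : _ = [set: J * I]); last by apply/seteqP; split.
rewrite (@reindex_esum _ _ _ [set: J * I] _ (fun q => (q.2, q.1)))//.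
by split=> // [[? ?] [? ?] _ _ [-> ->]//|[i j] _]; exists (j, i).
Qed.

Lemma esum_ge1 (K : choiceType) (u : K -> \bar R) k : (forall k, 0 <= u k)%E ->
  (u k <= \esum_(k in [set: K]) u k)%E.
Proof.
by move=> u0; apply: esum_ge; exists [set k]; rewrite ?fsbig_set1//; split.
Qed.

Lemma col_subproof f j : (fun i => f (i, j)) \in @l2_pred R I.
Proof.
rewrite inE; apply: le_lt_trans (sqsum_lty f).
rewrite [leRHS]esum_pair_swap => [|p]; last by rewrite lee_fin sqmod_ge0.
apply: (@esum_ge1 _ (fun j => sqsum (fun i => f (i, j)))) => k.
exact: sqsum_ge0.
Qed.
Definition col f j : l2 R I := L2 (col_subproof f j).

Lemma row_subproof f i : (fun j => f (i, j)) \in @l2_pred R J.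
Proof.
rewrite inE; apply: le_lt_trans (sqsum_lty f).
rewrite [leRHS]esum_pair => [|p]; last by rewrite lee_fin sqmod_ge0.
apply: (@esum_ge1 _ (fun i => sqsum (fun j => f (i, j)))) => k.
exact: sqsum_ge0.
Qed.
Definition row f i : l2 R J := L2 (row_subproof f i).

Lemma ampl1_bound S (M : R) f : 0 <= M ->
  (forall h, sqsum (S h) <= M%:E * sqsum h)%E ->
  (sqsum (fun p => S (col f p.2) p.1) <= M%:E * sqsum f)%E.
Proof.
move=> M0 SM; rewrite /sqsum.
rewrite !esum_pair_swap => [|p|p]; try by rewrite lee_fin sqmod_ge0.
apply: le_trans (esumZ_le _ _ _) => //= [|j].
  by apply: le_esum => j _; exact: SM (col f j).
exact: (sqsum_ge0 (col f j)).
Qed.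

Lemma ampl2_bound T (M : R) f : 0 <= M ->
  (forall h, sqsum (T h) <= M%:E * sqsum h)%E ->
  (sqsum (fun p => T (row f p.1) p.2) <= M%:E * sqsum f)%E.
Proof.
move=> M0 TM; rewrite /sqsum.
rewrite !esum_pair => [|p|p]; try by rewrite lee_fin sqmod_ge0.
apply: le_trans (esumZ_le _ _ _) => //= [|i].
  by apply: le_esum => i _; exact: TM (row f i).
exact: (sqsum_ge0 (row f i)).
Qed.

Lemma ampl1_l2 S f : (fun p => S (col f p.2) p.1) \in @l2_pred R (I * J)%type.
Proof.
have [M M0 SM] := bop_bounded S; rewrite inE.
apply: le_lt_trans (ampl1_bound f M0 SM) _.
by rewrite lte_mul_pinfty ?sqsum_lty.
Qed.

Lemma ampl2_l2 T f : (fun p => T (row f p.1) p.2) \in @l2_pred R (I * J)%type.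
Proof.
have [M M0 TM] := bop_bounded T; rewrite inE.
apply: le_lt_trans (ampl2_bound f M0 TM) _.
by rewrite lte_mul_pinfty ?sqsum_lty.
Qed.

Lemma ampl1_subproof S : (fun f => L2 (ampl1_l2 S f)) \in bounded_op_pred.
Proof.
apply: mk_bop_subproof => [a f h|].
  apply: l2P => p; rewrite l2_addE l2_scaleE /=.
  rewrite (_ : col _ _ = a *: col f p.2 + col h p.2); last exact: l2P.
  by rewrite linearP l2_addE l2_scaleE.
by have [M M0 SM] := bop_bounded S; exists M => // f; exact: ampl1_bound.
Qed.

Lemma ampl2_subproof T : (fun f => L2 (ampl2_l2 T f)) \in bounded_op_pred.
Proof.
apply: mk_bop_subproof => [a f h|].
  apply: l2P => p; rewrite l2_addE l2_scaleE /=.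
  rewrite (_ : row _ _ = a *: row f p.1 + row h p.1); last exact: l2P.
  by rewrite linearP l2_addE l2_scaleE.
by have [M M0 TM] := bop_bounded T; exists M => // f; exact: ampl2_bound.
Qed.

(* l2(I) (x) l2(J) is realised as l2(I * J), with e_i (x) e_j = e_(i,j);
   S (x) T is the product of S (x) 1 and 1 (x) T. *)
Definition tensor S T : bop R (I * J)%type :=
  bop_comp (Bop (ampl1_subproof S)) (Bop (ampl2_subproof T)).

Lemma tensor_basis S T i j p :
  tensor S T (basis (i, j)) p = S (basis i) p.1 * T (basis j) p.2.
Proof.
rewrite /tensor /= (_ : col _ p.2 = T (basis j) p.2 *: basis i).
  by rewrite linearZ l2_scaleE mulrC.
apply: l2P => k; rewrite l2_scaleE /=.
rewrite (_ : row _ k = (k == i)%:R *: basis j).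
  by rewrite linearZ l2_scaleE mulrC.
apply: l2P => l; rewrite l2_scaleE /= xpair_eqE.
by case: (k == i); rewrite /= ?mul1r ?mul0r.
Qed.

End Tensor.

Definition bishift (R : realType) (n : int) : bop R int :=
  xget (0 : bop R int) [set T : bop R int | forall k : int, T (basis k) = basis (n + k)].

Lemma bishift_basis (R : realType) (n k : int) :
  bishift R n (basis k) = basis (n + k).
Proof.
have [T [TE _]] := @weighted_injection R int int id (fun k => n + k)
  (fun=> 1) 1 (@inj_id int) (addrI n) ler01
  (fun=> eq_ind_r (fun z => z <= 1) (lexx 1) (sqmod1 (R := R))).
rewrite /bishift; case: xgetP => [S _ SE|/(_ T) []]; first exact: SE.
by move=> l; rewrite TE scale1r.
Qed.

Section Topology.
Context {X : topologicalType}.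

Definition nowhere_dense (A : set X) := (closure A)° = set0.

Definition comeager (A : set X) :=
  exists2 F : (set X)^nat, forall n, nowhere_dense (F n) & ~` A = \bigcup_n F n.

Definition embedding (f : X -> X) :=
  [/\ injective f, continuous f
    & forall O, open O -> exists2 O', open O' & f @` O = O' `&` range f].

End Topology.

Section IFS.
Context {X : topologicalType} {N : nat} (g : 'I_N -> X -> X).
Implicit Types (S : set X) (k l w : seq 'I_N) (x y : X).

(* The sequence [:: k_n; ...; k_1] stands for g_(k_n) \o ... \o g_(k_1). *)
Definition word_map w x : X := foldr g x w.

Definition ifs_image S : set X := \bigcup_(i in [set: 'I_N]) (g i @` S).

Definition completely_invariant S :=
  forall i, g i @` S `<=` S /\ g i @^-1` S `<=` S.

Definition essentially_free :=
  forall k l, k <> l -> nowhere_dense [set x | word_map k x = word_map l x].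

Definition ifs_graph : set (X * X) := [set p | exists i, p.1 = g i p.2].

(* The chain (x_n, ..., x_0) is the function i |-> x_i. *)
Definition is_chain n (c : {ptws 'I_n.+1 -> X}) :=
  forall i : 'I_n, exists j, c (lift ord0 i) = g j (c (widen_ord (leqnSn n) i)).

Definition chain_of n (w : n.-tuple 'I_N) x : {ptws 'I_n.+1 -> X} :=
  fun i => word_map (drop (n - i) w) x.

Definition chain_pairs m n :
    set ({ptws 'I_m.+1 -> X} * {ptws 'I_n.+1 -> X}) :=
  [set p | [/\ is_chain p.1, is_chain p.2 & p.1 ord0 = p.2 ord0]].

End IFS.

Arguments chain_pairs {X N} g m n _.

Section Representation.
Context (R : realType) {X : topologicalType} {N : nat} (g : 'I_N -> X -> X).
Variable XX : set X.

(* e_x for x in XX (see basis_at_val); 0 off XX. *)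
Definition basis_at (x : X) : l2 R XX :=
  if insub x is Some z then basis z else 0.

(* Each operator below is the only one with the stated values on the basis
   (bop_ext, basis_at_val); that it exists is proved in rhoA_basis, rhoE_basis
   and rhomn_basis.  Functions on a compact set G are represented by functions
   on the ambient space that are continuous within G; their values off G are
   not used. *)
Definition rhoA (a : X -> Cx R) : bop R XX :=
  xget (0 : bop R XX)
    [set T : bop R XX | forall x, XX x -> T (basis_at x) = a x *: basis_at x].

Definition rhoE (f : X * X -> Cx R) : bop R XX :=
  xget (0 : bop R XX)
    [set T : bop R XX | forall y, XX y ->
       T (basis_at y) = \sum_(i < N) f (g i y, y) *: basis_at (g i y)].

Definition rhomn_spec m n
    (f : {ptws 'I_m.+1 -> X} * {ptws 'I_n.+1 -> X} -> Cx R) : set (bop R XX) :=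
  [set T : bop R XX | (forall (k : n.-tuple 'I_N) x, XX x ->
              T (basis_at (word_map g k x)) =
              \sum_(j : m.-tuple 'I_N)
                f (chain_of g j x, chain_of g k x) *: basis_at (word_map g j x))
        /\ (forall y, XX y -> ~ iter n (ifs_image g) XX y ->
              T (basis_at y) = 0)].

Definition rhomn m n f : bop R XX := xget (0 : bop R XX) (@rhomn_spec m n f).

Definition Emn m n : set (bop R XX) :=
  [set rhomn f | f in [set f | {within chain_pairs g m n, continuous f}]].

Definition Bk (k : int) : set (bop R XX) :=
  norm_closure (lin_span
    [set T : bop R XX | exists m n : nat, m%:Z - n%:Z = k /\ Emn m n T]).

Definition Dk (k : int) : set (bop R XX) := Bk k `&` diagonal_ops.

Definition Dhat : set (bop R (XX * int)%type) :=
  norm_closure (lin_span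
    (\bigcup_(k in [set: int]) [set tensor T (bishift R k) | T in Dk k])).

Definition rhoA_hat (a : X -> Cx R) := tensor (rhoA a) (bishift R 0).

Definition rhoE_hat (f : X * X -> Cx R) := tensor (rhoE f) (bishift R 1).

Definition rhoA_hat_range : set (bop R (XX * int)%type) :=
  [set rhoA_hat a | a in [set a | continuous a]].

Definition rhoE_hat_range : set (bop R (XX * int)%type) :=
  [set rhoE_hat f | f in [set f | {within ifs_graph g, continuous f}]].

(* The minimal tensor product of the bounded operators on l2(XX) with C*(Z) acts
   faithfully on l2(XX * int); C*-subalgebras of it are generated there. *)
Definition cstar_rho_hat : set (bop R (XX * int)%type) :=
  cstar_generated (rhoA_hat_range `|` rhoE_hat_range).

Lemma basis_at_val (z : XX) : basis_at (val z) = basis z.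
Proof. by rewrite /basis_at valK. Qed.

End Representation.

Arguments rhomn R {X N} g XX m n f.
Arguments Emn R {X N} g XX m n _.
Arguments Bk R {X N} g XX k _.
Arguments Dk R {X N} g XX k _.
Arguments Dhat R {X N} g XX _.
Arguments rhoA_hat_range R {X} XX _.
Arguments rhoE_hat_range R {X N} g XX _.
Arguments cstar_rho_hat R {X N} g XX _.

Section WellDefined.
Context {R : realType} {X : topologicalType} {N : nat} (g : 'I_N -> X -> X).
Variable XX : set X.
Hypothesis cX : compact [set: X].
Hypothesis cg : forall i, continuous (g i).
Hypothesis gXX : forall i, g i @` XX `<=` XX.
Hypothesis dXX : trivIset [set: 'I_N] (fun i => g i @` XX).
Hypothesis iXX : forall i, {in XX &, injective (g i)}.

Lemma within_continuous_precomp (Y Z : topologicalType) (G : set Y) (p : X -> Y)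
    (f : Y -> Z) : (forall x, G (p x)) -> continuous p ->
  {within G, continuous f} -> continuous (f \o p).
Proof.
move=> Gp cp /subspace_continuousP cf x U /(cf _ (Gp x)) Uf.
have H : nbhs x [set y | G (p y) -> U (f (p y))] := cp x _ Uf.
by have : nbhs x [set y | U (f (p y))] by apply: filterS H => y; exact.
Qed.

Lemma continuous_bounded (h : X -> Cx R) : continuous h ->
  exists2 M : R, 0 <= M & forall x, sqmod (h x) <= M.
Proof.
move=> ch.
have sq1 (z : Cx R) : `|z| < 1 -> sqmod z <= 1.
  move=> z1; have : `|z| ^+ 2 <= 1 by rewrite expr_le1// ltW.
  rewrite -[X in X <= _]add_Re2_Im2 -[1 in X in X -> _](rmorph1 (real_complex R)).
  by rewrite lecR.
have := (compact_near_coveringP [set: X]).1 cX R (pinfty_nbhs R)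
  (fun M x => sqmod (h x) <= M) _.
case=> [x _|M [_ MP]].
  exists ([set y | `|h x - h y| < 1], [set M | 2 * (sqmod (h x) + 1) < M]).
    split; last by exists (2 * (sqmod (h x) + 1)); split=> //; rewrite num_real.
    by have /cvgrPdist_lt/(_ 1 ltr01) := ch x.
  move=> [y M] /= [xy Mx]; apply: le_trans (ltW Mx).
  rewrite [h y](_ : _ = h x + - (h x - h y)); last by rewrite opprB addrC subrK.
  apply: le_trans (sqmodD _ _) _; rewrite ler_wpM2l// lerD2l sq1//.
  by rewrite normrN.
exists (`|M| + 1) => [|x]; first by rewrite addr_ge0.
by apply: MP => //; rewrite (le_lt_trans (ler_norm _))// ltrDl.
Qed.

Lemma word_map_in w x : XX x -> XX (word_map g w x).
Proof.
by move=> Xx; elim: w => //= i w IH; apply: (gXX (i := i)); exists (word_map g w x).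
Qed.

Lemma word_map_inj k l x y : size k = size l -> XX x -> XX y ->
  word_map g k x = word_map g l y -> k = l /\ x = y.
Proof.
move=> + Xx Xy; elim: k l => [|i k IH] [|j l] //= [] /IH kl E.
have Xk := word_map_in k Xx; have Xl := word_map_in l Xy.
have ij : i = j.
  have /(_ Logic.I Logic.I) := @dXX i j; apply; exists (g i (word_map g k x)).
  by split; [exists (word_map g k x)|rewrite E; exists (word_map g l y)].
rewrite -ij in E *; have [|-> ->//] := kl.
by apply: iXX E; exact/mem_set.
Qed.

Definition wm w (z : XX) : XX :=
  exist _ (word_map g w (val z)) (mem_set (word_map_in w (set_valP z))).

Lemma basis_at_word w (z : XX) :
  basis_at R XX (word_map g w (val z)) = basis (wm w z).
Proof. by rewrite -basis_at_val. Qed.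

Lemma wm_inj w : injective (wm w).
Proof.
move=> y z /(congr1 val) /= E; apply: val_inj.
by have [] := word_map_inj erefl (set_valP y) (set_valP z) E.
Qed.

Lemma continuous_word w : continuous (word_map g w).
Proof.
elim: w => [|i w IH] x; first exact: cvg_id.
exact: (@continuous_comp _ _ _ (word_map g w) (g i) x (IH x) (@cg i _)).
Qed.

Lemma rhoA_basis a x : continuous a -> XX x ->
  rhoA XX a (basis_at R XX x) = a x *: basis_at R XX x.
Proof.
move=> ca; have [M M0 aM] := continuous_bounded ca; move: x.
have [T [TE _]] := @weighted_injection R XX XX id id (fun z => a (val z)) M
  (@inj_id XX) (@inj_id XX) M0 (fun z => aM (val z)).
rewrite /rhoA; case: xgetP => [S _ SE|/(_ T) []]; first exact: SE.
move=> x Xx; pose z : XX := exist _ x (mem_set Xx).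
by rewrite (_ : x = val z)// basis_at_val; exact: TE.
Qed.

Lemma rhoE_basis f y : {within ifs_graph g, continuous f} -> XX y ->
  rhoE g XX f (basis_at R XX y) =
  \sum_(i < N) f (g i y, y) *: basis_at R XX (g i y).
Proof.
move=> cf.
have cfi i : continuous (fun y => f (g i y, y)).
  have cp : continuous (fun y => (g i y, y)).
    by move=> x; apply: cvg_pair; [exact: cg|exact: cvg_id].
  by apply: within_continuous_precomp cp cf => x; exists i.
have T_ i : exists T : bop R XX, forall y, XX y ->
    T (basis_at R XX y) = f (g i y, y) *: basis_at R XX (g i y).
  have [M M0 fM] := continuous_bounded (cfi i).
  have [T [TE _]] := @weighted_injection R XX XX id (wm [:: i])
    (fun z => f (g i (val z), val z)) M
    (@inj_id XX) (@wm_inj _) M0 (fun z => fM (val z)).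
  exists T => {}y Xy; pose z : XX := exist _ y (mem_set Xy).
  rewrite (_ : y = val z)// basis_at_val (basis_at_word [:: i] z); exact: TE.
move: y; have [T TE] := choice T_.
rewrite /rhoE; case: xgetP => [S _ SE|/(_ (\sum_i T i)) []]; first exact: SE.
by move=> y Xy; rewrite bop_sumE; apply: eq_bigr => i _; exact: TE.
Qed.

Lemma chain_ofP n (w : n.-tuple 'I_N) x : is_chain g (chain_of g w x).
Proof.
move=> i; rewrite /chain_of /= /bump /= add1n.
have lt : (n - i.+1 < size w)%N.
  by rewrite size_tuple ltn_subrL /= (leq_ltn_trans _ (ltn_ord i)).
exists (nth (tnth w i) w (n - i.+1)).
by rewrite (drop_nth (tnth w i) lt) subnSK.
Qed.

Lemma chain_of0 n (w : n.-tuple 'I_N) x : chain_of g w x ord0 = x.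
Proof. by rewrite /chain_of /= subn0 drop_oversize// size_tuple. Qed.

Lemma continuous_chain_of n (w : n.-tuple 'I_N) :
  continuous (chain_of g w : X -> {ptws 'I_n.+1 -> X}).
Proof.
move=> x; apply/cvg_sup.
move=> i; move: x; apply/(@continuousP _ (initial_topology (@^~ i))) => A [B oB <-].
rewrite (_ : _ @^-1` _ = word_map g (drop (n - i) w) @^-1` B)//.
by apply: open_comp => // y _; exact: continuous_word.
Qed.

Lemma rhomn_basis m n
    (f : {ptws 'I_m.+1 -> X} * {ptws 'I_n.+1 -> X} -> Cx R) :
  {within chain_pairs g m n, continuous f} ->
  @rhomn_spec R X N g XX m n f (rhomn R g XX m n f).
Proof.
move=> cf.
have cfjk (j : m.-tuple 'I_N) (k : n.-tuple 'I_N) :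
    continuous (fun x => f (chain_of g j x, chain_of g k x)).
  pose p x : {ptws 'I_m.+1 -> X} * {ptws 'I_n.+1 -> X} :=
    (chain_of g j x, chain_of g k x).
  have cp : continuous p.
    by move=> x; exact: cvg_pair (@continuous_chain_of _ j x)
                                 (@continuous_chain_of _ k x).
  have Gp x : chain_pairs g m n (p x).
    by split; rewrite /= ?chain_of0//; exact: chain_ofP.
  exact: within_continuous_precomp Gp cp cf.
have T_ (jk : m.-tuple 'I_N * n.-tuple 'I_N) : exists T : bop R XX,
    (forall z, T (basis (wm jk.2 z)) =
       f (chain_of g jk.1 (val z), chain_of g jk.2 (val z)) *:
         basis (wm jk.1 z)) /\ (forall y, ~ range (wm jk.2) y -> T (basis y) = 0).
  case: jk => j k /=; have [M M0 fM] := continuous_bounded (cfjk j k).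
  exact: weighted_injection (@wm_inj k) (@wm_inj j) M0 (fun z => fM (val z)).
have [T TE] := choice T_.
rewrite /rhomn; case: xgetP => [S _ //|/(_ (\sum_k \sum_j T (j, k))) []].
split=> [k x Xx|y Xy Ny].
  pose z : XX := exist _ x (mem_set Xx).
  rewrite (_ : x = val z)// basis_at_word bop_sumE (bigD1 k)//= [X in _ + X]big1.
    rewrite addr0 bop_sumE; apply: eq_bigr => j _.
    by rewrite (basis_at_word j z); exact: (TE (j, k)).1 z.
  move=> l lk; rewrite bop_sumE big1// => j _.
  have [_ ->//] := TE (j, l); case=> y _ /(congr1 val)/= E.
  have [|/val_inj lk' _] := word_map_inj _ (set_valP y) (set_valP z) E.
    by rewrite !size_tuple.
  by rewrite lk' eqxx in lk.
pose z : XX := exist _ y (mem_set Xy).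
rewrite (_ : y = val z)// basis_at_val bop_sumE big1// => k _.
rewrite bop_sumE big1// => j _; have [_ ->//] := TE (j, k).
case=> x _ /(congr1 val)/= E; apply: Ny.
suff H w : iter (size w) (ifs_image g) XX (word_map g w (val x)).
  by rewrite -E -{1}(size_tuple k).
elim: w => [|i w IH] /=; first exact: set_valP.
by exists i => //; exists (word_map g w (val x)).
Qed.

End WellDefined.

(* Main.v *)
(* Two distinct words k, l agree on a nonempty open set W.  On XX words of equal
   length have disjoint images, so |k| <> |l|.  Cutting down to a point of W in
   XX by Urysohn functions, one gets S = T_k a T_l^*, where T_w is the weighted
   composition e_x |-> r(x) e_{w(x)}, a product of elements of E: on U the
   branches of the graph are relatively open, so they can be separated by
   continuous functions.  Then S lies in E_{|k|,|l|} and is diagonal because k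
   and l agree on W, while S (x) v_{|k|-|l|} is not in the range of rhoA_hat, its
   degree being nonzero.  The elements of C*(rho_hat) that are finite sums of
   diagonal operators times shifts form a commutative *-subalgebra containing
   both, which refutes maximality. *)
Require Import Defs.
From HB Require Import structures.
From mathcomp Require Import all_boot all_order all_algebra.
From mathcomp Require Import all_classical all_reals all_analysis.
From mathcomp Require Import complex ring.

Set Implicit Arguments.
Unset Strict Implicit.
Unset Printing Implicit Defensive.
Import Order.TTheory GRing.Theory Num.Theory.
Import numFieldNormedType.Exports.

Local Open Scope classical_set_scope.
Local Open Scope ring_scope.

(** * Bounded operators given on the basis *)

Section Operators.
Context {R : realType}.
Implicit Types (I J : choiceType).

Lemma basisE I (i j : I) : (Defs.basis i : l2 R I) j = (j == i)%:R.
Proof. by []. Qed.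

Lemma bopZ I (T : bop R I) a f : T (a *: f) = a *: T f.
Proof. exact: linearZZ. Qed.

Lemma rank_one I (i : I) (v : l2 R I) :
  exists T : bop R I, forall f, T f = f i *: v.
Proof.
have lT : linear (fun f : l2 R I => f i *: v).
  by move=> a f h; rewrite l2_addE l2_scaleE scalerDl scalerA.
have bT : (fun f : l2 R I => f i *: v) \in bounded_op_pred.
  apply: mk_bop_subproof => //; exists (fine (sqsum v)) => [|f].
    by rewrite fine_ge0// sqsum_ge0.
  rewrite fineK ?sqsum_fin//; apply: le_trans (sqsumZ _ _) _.
  rewrite muleC lee_wpmul2l ?sqsum_ge0//.
  apply: (@esum_ge1 _ _ (fun j => (sqmod (f j))%:E) i) => j.
  by rewrite lee_fin sqmod_ge0.
by exists (Bop bT).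
Qed.

(** Reading off one coordinate of [T f] needs no infinite expansion of [f]: the projection onto the
    line of [basis z], composed with [T], agrees on the basis with a rank-one operator, and bounded
    operators agreeing on the basis are equal. *)
Lemma bop_coord I (T : bop R I) i z f :
  (forall j, j != i -> T (Defs.basis j) z = 0) ->
  T f z = f i * T (Defs.basis i) z.
Proof.
move=> Tz; have [P PE] := rank_one z (Defs.basis z).
have [Q QE] := rank_one i (T (Defs.basis i) z *: Defs.basis z).
have PTQ : bop_comp P T = Q.
  apply: bop_ext => j; rewrite /= PE QE basisE eq_sym.
  by case: eqP => [->|/eqP /Tz ->]; rewrite ?scale1r// !scale0r.
have := congr1 (fun S : bop R I => S f z) PTQ.
by rewrite /= PE QE !l2_scaleE basisE eqxx !mulr1.
Qed.

Lemma rsum_inj I J (b : J -> I) (u : I -> R) : injective b ->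
  (forall i, ~ range b i -> u i = 0) -> rsum u = rsum (u \o b).
Proof.
move=> ib; have E (v : I -> R) : (forall i, ~ range b i -> v i = 0) ->
    (\esum_(i in [set: I]) (Num.max (v i) 0)%:E =
     \esum_(j in [set: J]) (Num.max (v (b j)) 0)%:E)%E.
  move=> v0; rewrite -(esum_image [set: J] b (fun i => (Num.max (v i) 0)%:E)).
    rewrite [RHS]esum_mkcond; apply: eq_esum => i _; case: ifPn => // /negP.
    by rewrite inE => /v0 ->; rewrite maxxx.
  by move=> x y _ _ /ib.
move=> u0; rewrite /rsum (E u)// (E (fun i => - u i))// => i /u0 ->.
exact: oppr0.
Qed.

Lemma csum_inj I J (b : J -> I) (u : I -> Cx R) : injective b ->
  (forall i, ~ range b i -> u i = 0) -> csum u = csum (u \o b).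
Proof.
by move=> ib u0; rewrite /csum; congr Complex; apply: rsum_inj => // i /u0 ->.
Qed.

Lemma dot_basis_r I (f : l2 R I) i : dot f (Defs.basis i) = (f i)^*.
Proof.
transitivity (dot (Defs.basis i) ((f i)^* *: Defs.basis i)).
  rewrite /dot; congr csum; apply: funext => j; rewrite l2_scaleE !basisE.
  by case: eqP => [->|_]; rewrite ?conjC1 ?conjC0 ?mul1r ?mul0r ?mulr0.
by rewrite dot_basis l2_scaleE basisE eqxx mulr1.
Qed.

Lemma adjoint_basis I (T T' : bop R I) i j : is_adjoint T T' ->
  T' (Defs.basis i) j = (T (Defs.basis j) i)^*.
Proof. by move=> TT'; rewrite -dot_basis TT' dot_basis_r. Qed.

(** [T f] is supported on the range of [b], so both inner products, reindexed along [b], have the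
    same terms: the conjugate of [w i * f i] times [h (b i)]. *)
Lemma adjoint_weighted_injection I (b : I -> I) (w : I -> Cx R)
    (T T' : bop R I) : injective b ->
  (forall i, T (Defs.basis i) = w i *: Defs.basis (b i)) ->
  (forall i, T' (Defs.basis (b i)) = (w i)^* *: Defs.basis i) ->
  (forall i, ~ range b i -> T' (Defs.basis i) = 0) ->
  is_adjoint T T'.
Proof.
move=> ib TE T'E T'0 f h.
have Tb i : T f (b i) = w i * f i.
  rewrite (@bop_coord _ T i) => [|j ji]; rewrite TE l2_scaleE basisE.
    by rewrite eqxx mulr1 mulrC.
  by rewrite (inj_eq ib) eq_sym (negbTE ji) mulr0.
have T0 i : ~ range b i -> T f i = 0.
  move=> Ni; have Tj j : T (Defs.basis j) i = 0.
    rewrite TE l2_scaleE basisE [i == b j]negbTE ?mulr0//.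
    by apply/eqP => ij; apply: Ni; exists j.
  by rewrite (@bop_coord _ T i) ?Tj ?mulr0// => j _; rewrite Tj.
have T'b i : T' h i = (w i)^* * h (b i).
  rewrite (@bop_coord _ T' (b i)) => [|j ji].
    by rewrite T'E l2_scaleE basisE eqxx mulr1 mulrC.
  have [[k _ kj]|/T'0 ->//] := pselect (range b j).
  rewrite -kj T'E l2_scaleE basisE [i == k]negbTE ?mulr0//.
  by apply: contraNneq ji => ->; rewrite kj.
rewrite /dot [RHS](csum_inj ib) => [|i /T0 ->]; last by rewrite conjC0 mul0r.
congr csum; apply: funext => i /=; rewrite Tb T'b rmorphM; ring.
Qed.

Lemma norm_closure_sub I (A : set (bop R I)) : A `<=` norm_closure A.
Proof.
move=> T AT e e0; exists T => //; rewrite subrr /opnorm.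
have l0 : l2norm (0 : l2 R I) = 0.
  by rewrite /l2norm /sqsum esum1 ?sqrtr0// => i _; rewrite sqmod0.
rewrite [X in sup X](_ : _ = [set 0]) ?sup1//.
apply/seteqP; split => [_ [f _ <-]|_ ->] /=; first exact: l0.
by exists 0; rewrite /= ?l0.
Qed.

Lemma lin_span_sub I (A : set (bop R I)) : A `<=` lin_span A.
Proof.
move=> T AT; exists 1%N, (fun=> 1), (fun=> T); split=> //.
by rewrite big_ord1 scale1r.
Qed.

Lemma star_subalgebra_generated I (A : set (bop R I)) :
  is_star_subalgebra (cstar_generated A).
Proof.
split=> [B [[[B0 _ _ _] _] _]//|a S T AS AT B BA|S T AS AT B BA|T T' AT TT' B BA].
- by have [[[_ + _ _] _] _] := BA; apply; [exact: AS|exact: AT].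
- by have [[[_ _ + _] _] _] := BA; apply; [exact: AS|exact: AT].
- by have [[[_ _ _ H] _] _] := BA; exact: H (AT _ BA) TT'.
Qed.

End Operators.

(** * Diagonal operators times shifts *)

Section ShiftDiagonal.
Context {R : realType} {I : choiceType}.

Lemma tensor_shift (S : bop R I) (n : int) x y c i :
  S (Defs.basis x) = c *: Defs.basis y ->
  tensor S (bishift R n) (Defs.basis (x, i)) = c *: Defs.basis (y, n + i).
Proof.
move=> Sx; apply: l2P => -[z j].
rewrite tensor_basis bishift_basis Sx !l2_scaleE !basisE xpair_eqE /=.
by rewrite -mulrA; case: (z == y); rewrite ?mul1r ?mul0r.
Qed.

(* Finite sums of terms d (x) v_k with d diagonal, given by the pairs (k, d);
   the diagonals d need not be bounded individually. *)
Definition shift_diagonal : set (bop R (I * int)%type) :=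
  [set T : bop R (I * int)%type | exists s : seq (int * (I -> Cx R)),
     forall x i, T (Defs.basis (x, i)) =
       \sum_(p <- s) p.2 x *: Defs.basis (x, p.1 + i)].

Lemma tensor_shift_diagonal (S : bop R I) (d : I -> Cx R) n :
  (forall x, S (Defs.basis x) = d x *: Defs.basis x) ->
  shift_diagonal (tensor S (bishift R n)).
Proof.
move=> Sd; exists [:: (n, d)] => x i.
by rewrite (tensor_shift _ _ (Sd x)) big_seq1.
Qed.

(** Degrees add and coefficients multiply. The double sum is symmetric in the two operators, which
    gives commutativity as well as closure under products. *)
Lemma shift_diagonal_compE (S T : bop R (I * int)%type) s t :
  (forall x i, S (Defs.basis (x, i)) =
     \sum_(p <- s) p.2 x *: Defs.basis (x, p.1 + i)) ->
  (forall x i, T (Defs.basis (x, i)) =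
     \sum_(p <- t) p.2 x *: Defs.basis (x, p.1 + i)) ->
  forall x i, bop_comp S T (Defs.basis (x, i)) =
    \sum_(q <- t) \sum_(p <- s)
      (q.2 x * p.2 x) *: Defs.basis (x, p.1 + q.1 + i).
Proof.
move=> SE TE x i; rewrite /= TE linear_sum; apply: eq_bigr => q _.
rewrite linearZ /= SE scaler_sumr; apply: eq_bigr => p _.
by rewrite scalerA addrA.
Qed.

Lemma shift_diagonal_commutative : is_commutative shift_diagonal.
Proof.
move=> S T [s SE] [t TE]; apply: bop_ext => -[x i].
rewrite (shift_diagonal_compE SE TE) (shift_diagonal_compE TE SE) exchange_big.
by apply: eq_bigr => p _; apply: eq_bigr => q _; rewrite mulrC (addrC p.1).
Qed.

Lemma shift_diagonal_star_subalgebra : is_star_subalgebra shift_diagonal.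
Proof.
split=> [|a S T [s SE] [t TE]|S T [s SE] [t TE]|T T' [t TE] TT'].
- by exists [::] => x i; rewrite big_nil.
- exists ([seq (p.1, fun x => a * p.2 x) | p <- s] ++ t) => x i.
  rewrite [LHS](_ : _ = a *: S (Defs.basis (x, i)) + T (Defs.basis (x, i)))//.
  rewrite SE TE big_cat big_map scaler_sumr; congr (_ + _).
  by apply: eq_bigr => p _; rewrite scalerA.
- exists [seq (p.1 + q.1, fun x => q.2 x * p.2 x) | q <- t, p <- s] => x i.
  by rewrite (shift_diagonal_compE SE TE) big_allpairs_dep.
(* Adjoints reverse the degree and conjugate the diagonal; this is checked on matrix entries. *)
- exists [seq (- p.1, fun x => (p.2 x)^*) | p <- t] => x i.
  have sumE K (r : seq K) (F : K -> l2 R (I * int)%type) z :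
      (\sum_(p <- r) F p) z = \sum_(p <- r) F p z.
    by elim/big_rec2: _ => //= p u v _ <-.
  have conjM (a : Cx R) (b : bool) : (a * b%:R)^* = a^* * b%:R.
    by rewrite rmorphM /= conjC_nat.
  apply: l2P => -[y j]; rewrite (adjoint_basis _ _ TT') TE !sumE rmorph_sum.
  rewrite big_map; apply: eq_bigr => p _.
  rewrite !l2_scaleE !basisE !xpair_eqE [LHS]conjM [x == y]eq_sym.
  case: eqP => [->|_]; rewrite ?mulr0//=; congr (_ * (nat_of_bool _)%:R).
  by apply/eqP/eqP => ->; rewrite ?addKr ?addNKr.
Qed.

End ShiftDiagonal.

(** * Chains over the separating open set *)

Section Cutoff.
Context {R : realType} {X : topologicalType}.

Lemma closed_coincidence (Y : topologicalType) (u v : Y -> X) :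
  hausdorff_space X -> continuous u -> continuous v ->
  closed [set y | u y = v y].
Proof.
move=> hX cu cv; rewrite -openC openE => y /= /eqP uv.
move: hX; rewrite open_hausdorff => /(_ _ _ uv)[[A B] /= [/set_mem uA /set_mem vB]].
move=> [oA oB /eqP AB0].
have uy : nbhs y (u @^-1` A) by apply: cu; exact: open_nbhs_nbhs.
have vy : nbhs y (v @^-1` B) by apply: cv; exact: open_nbhs_nbhs.
apply: filterS2 uy vy => z /= uz vz E.
have : (A `&` B) (u z) by split; rewrite // E.
by rewrite AB0.
Qed.

Lemma continuous_real_complex (r : X -> R) : continuous r ->
  continuous (fun x => (r x)%:C%C : Cx R).
Proof.
move=> cr x; apply/cvgrPdist_lt => e e0.
(* A positive element of [Cx R] is real, so the radius [e] comes from [R]. *)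
have er : e = (complex.Re e)%:C%C by rewrite RRe_real// gtr0_real.
move: e0; rewrite er ltcR => e0.
have /cvgrPdist_lt/(_ _ e0) := cr x.
apply: filterS => y; rewrite -rmorphB /= normc_def /=.
by rewrite expr0n addr0 sqrtr_sqr ltcR.
Qed.

Lemma urysohn_bump (W : set X) x : compact [set: X] -> hausdorff_space X ->
  open W -> W x ->
  exists r : X -> R, [/\ continuous r, r x = 1 & forall y, ~ W y -> r y = 0].
Proof.
move=> cX hX oW Wx.
have c1 : closed [set x] by apply: accessible_closed_set1; exact: hausdorff_accessible.
have [|r [cr r0 r1 _]] := @urysohn_ext_itv X R (compact_normal hX cX)
  (~` W) [set x] 0 1 (open_closedC oW) c1 _ ltr01.
  by apply/seteqP; split=> // y [/= Wy yx]; apply: Wy; rewrite yx.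
exists r; split=> // [|y Wy]; first by apply: r1; exists x.
by apply: r0; exists y.
Qed.

(* Off [U] the function [h] vanishes, so [O] need only be relatively open in
   [G] over [U]. *)
Lemma within_continuous_cutoff (Y Z : topologicalType) (G O : set Y)
    (b : Y -> X) (U : set X) (h : X -> Z) (z0 : Z) :
  closed O -> continuous b -> continuous h -> (forall x, ~ U x -> h x = z0) ->
  (forall p, G p -> O p -> U (b p) -> nbhs p [set q | G q -> O q]) ->
  {within G, continuous (fun q => if q \in O then h (b q) else z0)}.
Proof.
move=> cO cb ch h0 GO; apply/subspace_continuousP => p Gp A.
change (nbhs (if p \in O then h (b p) else z0) A ->
  nbhs p [set q | G q -> A (if q \in O then h (b q) else z0)]).
have [Op|NOp] := pselect (O p); last first.
  rewrite memNset// => /nbhs_singleton Az.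
  have : nbhs p (~` O) by apply: open_nbhs_nbhs; split=> //; exact: closed_openC.
  by apply: filterS => q Oq _ /=; rewrite memNset.
rewrite mem_set// => Ah.
have Ab : nbhs p [set q | A (h (b q))] := cb p _ (ch (b p) _ Ah).
have [Ub|NUb] := pselect (U (b p)).
  by apply: filterS2 Ab (GO _ Gp Op Ub) => q Aq GOq /GOq Oq /=; rewrite mem_set.
(* Here [h (b p)] is itself [z0], so [A] contains [z0] and nearby points off [O] do no harm. *)
apply: filterS Ab => q Aq _ /=; case: ifP => // _.
by move: Ah; rewrite (h0 _ NUb) => /nbhs_singleton.
Qed.

End Cutoff.

Section Chains.
Context {X : topologicalType} {N : nat} (g : 'I_N -> X -> X) (U : set X).
Hypothesis oU : open U.
Hypothesis dU : trivIset [set: 'I_N] (fun i => g i @` U).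
Hypothesis ogU : forall i, open (g i @` U).
Hypothesis gU : forall i, g i @` U `<=` U.

Lemma proj_ptws_continuous (I : eqType) (i : I) :
  continuous (fun c : {ptws I -> X} => c i).
Proof. exact: (@proj_continuous I (fun=> X) i). Qed.

(** An open set containing the image of [U] under [w]. For nonempty [w] it also records the map
    applied last, as the sets [g i (U)] are disjoint. *)
Let cell (w : seq 'I_N) : set X := if w is i :: _ then g i @` U else U.

Let open_cell w : open (cell w). Proof. by case: w => /=. Qed.

Let cell_sub w : cell w `<=` U. Proof. by case: w => /=. Qed.

Let word_cell w x : U x -> cell w (word_map g w x).
Proof.
move=> Ux; elim: w => //= i w IH; exists (word_map g w x) => //.
exact: cell_sub IH.
Qed.

(* Over [U] a chain determines the word producing it, as [U] separates the
   images of the maps. *)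
Let chain_unique n (w : n.-tuple 'I_N) (c : {ptws 'I_n.+1 -> X}) :
  is_chain g c -> (forall i : 'I_n.+1, cell (drop (n - i) w) (c i)) ->
  c = chain_of g w (c ord0).
Proof.
move=> cc cw; apply: funext => -[i lin].
elim: i lin => [|i IH] lin.
  by rewrite [Ordinal lin](_ : _ = ord0) ?chain_of0//; exact: val_inj.
pose i' : 'I_n := Ordinal (lin : (i < n)%N).
have E1 : lift ord0 i' = Ordinal lin by exact: val_inj.
have E2 : widen_ord (leqnSn n) i' = Ordinal (ltnW lin) by exact: val_inj.
have [j] := cc i'; rewrite E1 E2 => cj.
(* Words list the last map first, so the step from entry [i] to entry [i.+1] uses the letter at
   position [n - i.+1]. *)
have lt : (n - i.+1 < size w)%N.
  by rewrite size_tuple ltn_subrL /= (leq_ltn_trans (leq0n i)).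

have := cw (Ordinal lin); rewrite /= cj (drop_nth (tnth w i') lt) /=.
set k := nth _ _ _ => gk; have jk : j = k.
  have /(_ Logic.I Logic.I) := @dU j k; apply; exists (g j (c (Ordinal (ltnW lin)))).
  by split=> //; exists (c (Ordinal (ltnW lin))) => //; exact: cell_sub (cw _).
rewrite jk (IH (ltnW lin)) /chain_of /=.
by rewrite (drop_nth (tnth w i') lt) /= subnSK.
Qed.

(** Lying in the prescribed open cells is an open condition on finitely many coordinates, and it
    forces a chain to follow [w]. This is the relative openness that the cutoff of functions on
    chains requires. *)
Lemma near_chain_of n (w : n.-tuple 'I_N) (c : {ptws 'I_n.+1 -> X}) :
  c = chain_of g w (c ord0) -> U (c ord0) ->
  nbhs c [set c' | is_chain g c' -> c' = chain_of g w (c' ord0)].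
Proof.
move=> cw Uc.
have : nbhs c [set c' | forall i : 'I_n.+1, cell (drop (n - i) w) (c' i)].
  apply: (@filter_forall _ _
    (fun (i : 'I_n.+1) (c' : {ptws _ -> X}) => cell (drop (n - i) w) (c' i))
    (nbhs c) (nbhs_filter c)) => i.
  have ci : open_nbhs (c i) (cell (drop (n - i) w)).
    by split; [exact: open_cell|rewrite cw; exact: word_cell].
  exact: (@proj_ptws_continuous _ i c _ (open_nbhs_nbhs ci)).
apply: (@filterS _ _ (nbhs_filter c)) => c' cellc' cc'; exact: chain_unique.
Qed.

End Chains.

Lemma closed_chain_of {X : topologicalType} {N : nat} (g : 'I_N -> X -> X) n
    (w : n.-tuple 'I_N) : hausdorff_space X -> (forall i, continuous (g i)) ->
  closed [set c : {ptws 'I_n.+1 -> X} | c = chain_of g w (c ord0)].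
Proof.
move=> hX cg; rewrite [X in closed X](_ : _ =
  \bigcap_(i in [set: 'I_n.+1])
    [set c | c i = word_map g (drop (n - i) w) (c ord0)]); last first.
  apply/seteqP; split=> [c cw i _|c cw]; first by rewrite /= {1}cw.
  by apply: funext => i; exact: cw i Logic.I.
apply: closed_bigI => i _; apply: closed_coincidence => //.
  exact: proj_ptws_continuous.
move=> c; apply: continuous_comp; first exact: proj_ptws_continuous.
exact: continuous_word.
Qed.

(** * Weighted compositions with words *)

Section Representation.
Context {R : realType} {X : topologicalType} {N : nat} (g : 'I_N -> X -> X).
Variable XX : set X.
Hypothesis cX : compact [set: X].
Hypothesis hX : hausdorff_space X.
Hypothesis cg : forall i, continuous (g i).
Hypothesis gXX : forall i, g i @` XX `<=` XX.
Hypothesis dXX : trivIset [set: 'I_N] (fun i => g i @` XX).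
Hypothesis iXX : forall i, {in XX &, injective (g i)}.

Lemma rhoA_basis_val (a : X -> Cx R) (x : XX) : continuous a ->
  rhoA XX a (Defs.basis x) = a (val x) *: Defs.basis x.
Proof.
by move=> ca; rewrite -basis_at_val rhoA_basis//; exact: set_valP.
Qed.

Lemma rhoA_Emn (a : X -> Cx R) : continuous a -> Emn R g XX 0 0 (rhoA XX a).
Proof.
move=> ca; pose f (p : {ptws 'I_1 -> X} * {ptws 'I_1 -> X}) := a (p.1 ord0).
have cf : {within chain_pairs g 0 0, continuous f}.
  apply: continuous_subspaceT => p; apply: (@continuous_comp _ _ _
    (fun p : {ptws 'I_1 -> X} * {ptws 'I_1 -> X} => p.1 ord0) a); last exact: ca.
  apply: (@continuous_comp _ _ _ fst (fun c : {ptws 'I_1 -> X} => c ord0)).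
    exact: cvg_fst.
  exact: proj_ptws_continuous.
exists f => //; apply: bop_ext => x.
have [/(_ [tuple] (val x) (set_valP x)) + _] := rhomn_basis cX cg gXX dXX iXX cf.
rewrite /= basis_at_val => ->; rewrite rhoA_basis_val// (bigD1 [tuple])//=.
by rewrite big1 ?addr0 ?basis_at_val// => j; rewrite tuple0.
Qed.

Lemma rhoA_hat_sub_Dhat : rhoA_hat_range R XX `<=` Dhat R g XX.
Proof.
move=> _ [a ca <-]; apply/norm_closure_sub/lin_span_sub.
exists 0 => //; exists (rhoA XX a) => //; split.
  by apply/norm_closure_sub/lin_span_sub; exists 0%N, 0%N; split=> //; exact: rhoA_Emn.
move=> x y xy; rewrite dot_basis rhoA_basis_val// l2_scaleE basisE.
by case: eqP => [/xy//|_]; rewrite mulr0.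
Qed.

Lemma rhoA_hat_sub_cstar : rhoA_hat_range R XX `<=` cstar_rho_hat R g XX.
Proof. by move=> T AT; apply: sub_gen_smallest; left. Qed.

Variable U : set X.
Hypothesis oU : open U.
Hypothesis dU : trivIset [set: 'I_N] (fun i => g i @` U).
Hypothesis ogU : forall i, open (g i @` U).
Hypothesis gU : forall i, g i @` U `<=` U.
Hypothesis XXU : XX `<=` U.

(** The symbol is [a] on the [i]-th branch of the graph and zero elsewhere. It is continuous within
    the graph because [a] vanishes off [U], while over [U] the neighbourhood [g i (U)] times [U]
    meets no other branch. *)
Lemma letter_operator (i : 'I_N) (a : X -> Cx R) : continuous a ->
  (forall x, ~ U x -> a x = 0) ->
  exists2 T, cstar_rho_hat R g XX T & forall x j,
    T (Defs.basis (x, j)) =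
    a (val x) *: Defs.basis (wm gXX [:: i] x, 1 + j).
Proof.
move=> ca a0; pose O : set (X * X) := [set p | p.1 = g i p.2].
pose f p : Cx R := if p \in O then a p.2 else 0.
have cf : {within ifs_graph g, continuous f}.
  apply: (within_continuous_cutoff (U := U)) => //.
  - apply: closed_coincidence => // p; first exact: cvg_fst.
    by apply: continuous_comp; [exact: cvg_snd|exact: cg].
  - by move=> p; exact: cvg_snd.
  - move=> p _ Op Up.
    have n1 : nbhs p (fst @^-1` (g i @` U)).
      apply: cvg_fst; apply: open_nbhs_nbhs; split=> //.
      by rewrite /= Op; exists p.2.
    have n2 : nbhs p (snd @^-1` U) by apply: cvg_snd; exact: open_nbhs_nbhs.
    apply: filterS2 n1 n2 => q /= iq Uq [j jq]; rewrite /O /=.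
    have /(_ Logic.I Logic.I) <- // := @dU j i.
    by exists q.1; split=> //; rewrite jq; exists q.2.
exists (rhoE_hat g XX f).
  by apply: sub_gen_smallest; right; exists f.
move=> x j; apply: tensor_shift; rewrite -basis_at_val.
have Xx := set_valP x; rewrite (rhoE_basis cX cg gXX dXX iXX cf Xx).
(* Over a point of [XX] the other branches miss branch [i], so only its term survives. *)
rewrite (bigD1 i)//= big1 ?addr0 => [|k ki]; rewrite /f.
  by rewrite mem_set// (basis_at_word gXX [:: i] x).
rewrite memNset ?scale0r// => gk; move/eqP: ki; apply.
have /(_ Logic.I Logic.I) := @dXX k i; apply.
by exists (g k (val x)); split; [exists (val x)|exists (val x); rewrite // -gk].
Qed.

(* The cutoffs [r] are needed because the compositions with the maps themselves
   are not in the algebra: an element of E moves a point along every map. *)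
Lemma word_operator (w : seq 'I_N) (x0 : XX) : exists r T,
  [/\ continuous (r : X -> R), r (val x0) = 1, cstar_rho_hat R g XX T &
      forall x j, T (Defs.basis (x, j)) =
        (r (val x))%:C%C *: Defs.basis (wm gXX w x, (size w)%:Z + j)].
Proof.
elim: w => [|i w [r [T [cr r1 AT TE]]]].
  exists (fun=> 1), (rhoA_hat XX (fun=> 1)).
  have c1 : continuous (fun _ : X => 1 : Cx R) by move=> x; exact: cvg_cst.
  split=> [x|//||x j]; first exact: cvg_cst.
    by apply: rhoA_hat_sub_cstar; exists (fun=> 1).
  rewrite (tensor_shift _ _ (rhoA_basis_val _ c1)).
  by rewrite (_ : wm _ _ x = x)//; exact: val_inj.
have Uw : U (val (wm gXX w x0)) by apply: XXU; exact: set_valP.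
(* The bump is centred at the image of [x0] under [w], so the new cutoff [r x * s (word_map g w x)]
   is again 1 at [x0]. *)
have [s [cs s1 s0]] := urysohn_bump (R := R) cX hX oU Uw.
have [|S AS SE] := letter_operator i (continuous_real_complex cs).
  by move=> x /s0 ->.
have csw : continuous (s \o word_map g w).
  by move=> x; apply: continuous_comp; [exact: continuous_word|exact: cs].
exists (fun x => r x * s (word_map g w x)), (bop_comp S T); split.
- by move=> x; apply: cvgM; [exact: cr|exact: csw].
- by rewrite r1 mul1r.
- have [_ _ closed_comp _] := star_subalgebra_generated
    (rhoA_hat_range R XX `|` rhoE_hat_range R g XX).
  exact: closed_comp.
move=> x j; rewrite /= TE linearZ /= SE scalerA -rmorphM; congr (_ *: Defs.basis _).
by congr pair; [exact: val_inj|rewrite addrA intS].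
Qed.

(** The word map is injective on [XX], so the adjoint of the word operator can be written down as a
    weighted injection running backwards; its weight is the same because [r] is real. Closure under
    adjoints puts it in the algebra. *)
Lemma word_operator_adjoint (w : seq 'I_N) (x0 : XX) : exists r T,
  [/\ continuous (r : X -> R), r (val x0) = 1, cstar_rho_hat R g XX T,
      forall x j, T (Defs.basis (wm gXX w x, j)) =
        (r (val x))%:C%C *: Defs.basis (x, j - (size w)%:Z) &
      forall y j, ~ range (wm gXX w) y -> T (Defs.basis (y, j)) = 0].
Proof.
have [r [T [cr r1 AT TE]]] := word_operator w x0.
have [M M0 rM] := continuous_bounded cX (continuous_real_complex cr).
pose b (p : XX * int) := (wm gXX w p.1, (size w)%:Z + p.2).
have ib : injective b.
  move=> [x i] [y j] bxy; have /addrI/= -> := congr1 snd bxy.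
  by have /(wm_inj dXX iXX)/= -> := congr1 fst bxy.
have [T' [T'E T'0]] := weighted_injection (w := fun p => (r (val p.1))%:C%C)
  ib (@inj_id _) M0 (fun p => rM (val p.1)).
exists r, T'; split=> //.
- have [_ _ _ adj] := star_subalgebra_generated
    (rhoA_hat_range R XX `|` rhoE_hat_range R g XX).
  apply: adj AT _; apply: (adjoint_weighted_injection
    (w := fun p : XX * int => (r (val p.1))%:C%C) ib _ _ T'0) => -[x j].
    exact: TE.
  by rewrite T'E conj_Creal//; apply/complex_realP; exists (r (val x)).
- move=> x j; have := T'E (x, j - (size w)%:Z).
  by rewrite /b /= [_ + (_ - _)]addrC subrK.
- by move=> y j Ny; apply: T'0 => -[[x i] _ [xy _]]; apply: Ny; exists x.
Qed.

(** * Diagonal operators from coinciding words *)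

Lemma iter_image_word n y : iter n (ifs_image g) XX y ->
  exists (l : n.-tuple 'I_N) (x : XX), y = word_map g l (val x).
Proof.
elim: n y => [y Xy|n IH y [i _ [z /IH[l [x ->]] <-]]].
  by exists [tuple], (exist _ y (mem_set Xy)).
by exists [tuple of i :: l], x.
Qed.

(** The symbol takes the value of [h] at the common last entry on pairs of chains following [k] and
    [l], and zero on all others. On [XX] the end of a chain of given length determines its word, so
    only the pair [(k, l)] contributes. *)
Lemma rhomn_cutoff m n (k : m.-tuple 'I_N) (l : n.-tuple 'I_N)
    (h : X -> Cx R) : continuous h -> (forall x, ~ U x -> h x = 0) ->
  exists2 S : bop R XX, Emn R g XX m n S &
    (forall x, S (Defs.basis (wm gXX l x)) =
       h (val x) *: Defs.basis (wm gXX k x)) /\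
    forall y, ~ range (wm gXX l) y -> S (Defs.basis y) = 0.
Proof.
move=> ch h0.
pose Y := ({ptws 'I_m.+1 -> X} * {ptws 'I_n.+1 -> X})%type.
pose O : set Y := [set p | p.1 = chain_of g k (p.1 ord0)] `&`
                  [set p | p.2 = chain_of g l (p.2 ord0)].
have c1 : continuous (fst : Y -> _) by move=> p; exact: cvg_fst.
have c2 : continuous (snd : Y -> _) by move=> p; exact: cvg_snd.
pose f (p : Y) : Cx R := if p \in O then h (p.1 ord0) else 0.
have cf : {within chain_pairs g m n, continuous f}.
  apply: (within_continuous_cutoff (U := U) (b := fun p : Y => p.1 ord0)) => //.
  - apply: closedI.
      exact: (preimage_closed (fun p _ => c1 p) (closed_chain_of (w := k) hX cg)).
    exact: (preimage_closed (fun p _ => c2 p) (closed_chain_of (w := l) hX cg)).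
  - move=> p; apply: (@continuous_comp _ _ _ fst
      (fun c : {ptws 'I_m.+1 -> X} => c ord0)); first exact: c1.
    exact: proj_ptws_continuous.
  - move=> p [_ _ p12] [Op1 Op2] Up.
    have n1 := c1 p _ (near_chain_of oU dU ogU gU Op1 Up).
    (* The two chains share their entry of index 0, so the second one also starts in [U]. *)
    rewrite p12 in Up.
    have n2 := c2 p _ (near_chain_of oU dU ogU gU Op2 Up).
    apply: (@filterS2 _ _ (nbhs_filter p) _ _ _ _ n1 n2) => q /= q1 q2 [cq1 cq2 _].
    by split; [exact: q1|exact: q2].
have [SE S0] := rhomn_basis cX cg gXX dXX iXX cf.
have chain_last p (w : p.-tuple 'I_N) x : chain_of g w x ord_max = word_map g w x.
  by rewrite /chain_of /= subnn drop0.
have chain_inj p (v w : p.-tuple 'I_N) (x : XX) :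
    chain_of g v (val x) = chain_of g w (val x) -> v = w.
  move=> /(congr1 (fun c => c ord_max)); rewrite !chain_last => vw.
  have Xx := set_valP x; apply: val_inj.
  by have [] := word_map_inj gXX dXX iXX _ Xx Xx vw; rewrite ?size_tuple.
have fE j i (x : XX) : f (chain_of g j (val x), chain_of g i (val x)) =
    if (j == k) && (i == l) then h (val x) else 0.
  rewrite /f; case: ifPn => [/set_mem[]|].
    rewrite /= !chain_of0 => /chain_inj -> /chain_inj ->; by rewrite !eqxx.
  rewrite notin_setE => NO; case: ifPn => // /andP[/eqP jk /eqP il]; case: NO.
  by split; rewrite /= chain_of0 ?jk ?il.
have SE' (i : n.-tuple 'I_N) (x : XX) : rhomn R g XX m n f (Defs.basis (wm gXX i x)) =
    if i == l then h (val x) *: Defs.basis (wm gXX k x) else 0.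
  rewrite -basis_at_word SE; last exact: set_valP.
  rewrite (bigD1 k)//= fE eqxx big1 ?addr0 => [|j /negbTE jk].
    by rewrite (basis_at_word gXX); case: eqP => _; rewrite ?scale0r.
  by rewrite fE jk scale0r.
exists (rhomn R g XX m n f); first by exists f.
split=> [x|y Ny]; first by rewrite SE' eqxx.
have [/iter_image_word[i [x yx]]|Niter] := pselect (iter n (ifs_image g) XX (val y)).
  have -> : y = wm gXX i x by exact: val_inj.
  rewrite SE'; case: eqP => // il; case: Ny; exists x => //.
  by apply: val_inj; rewrite yx il.
by rewrite -basis_at_val S0//; exact: set_valP.
Qed.

(** The operator is obtained twice: as a cutoff in [Emn], which bounds its place in the grading,
    and, after tensoring with the shift, as a product of a word operator, a bump function and an
    adjoint word operator, which puts it in the algebra. *)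
Lemma coincidence_operator m n (k : m.-tuple 'I_N) (l : n.-tuple 'I_N)
    (W : set X) (x0 : XX) : open W -> W (val x0) ->
  (forall x, W x -> word_map g k x = word_map g l x) ->
  exists (S : bop R XX) d,
    [/\ Emn R g XX m n S,
        cstar_rho_hat R g XX (tensor S (bishift R (m%:Z - n%:Z))),
        forall y, S (Defs.basis y) = d y *: Defs.basis y &
        exists y, d y = 1].
Proof.
move=> oW Wx0 Wkl.
have [rk [Tk [crk rk1 ATk TkE]]] := word_operator k x0.
have [rl [Tl [crl rl1 ATl TlE Tl0]]] := word_operator_adjoint l x0.
have [|r [cr r1 r0]] := urysohn_bump (R := R) cX hX (openI oW oU) (x := val x0).
  by split=> //; exact/XXU/set_valP.
have cr' := continuous_real_complex cr.
pose T0 := rhoA_hat XX (fun x => (r x)%:C%C).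
have AT0 : cstar_rho_hat R g XX T0.
  by apply: rhoA_hat_sub_cstar; exists (fun x => (r x)%:C%C).
(* This is the total weight that the product [Tk], [T0], [Tl] collects at the image of [x] under
   [l]. *)
pose h x : Cx R := (rk x * r x * rl x)%:C%C.
have ch : continuous h.
  apply: continuous_real_complex => x; apply: cvgM; last exact: crl.
  by apply: cvgM; [exact: crk|exact: cr].
have h0 x : ~ (W `&` U) x -> h x = 0 by move=> /r0 rx; rewrite /h rx mulr0 mul0r.
have [|S ES [SE S0]] := rhomn_cutoff k l ch.
  by move=> x Ux; apply: h0 => -[].
have SdE y : exists c, S (Defs.basis y) = c *: Defs.basis y.
  have [[x _ <-]|Ny] := pselect (range (wm gXX l) y); last first.
    by exists 0; rewrite S0// scale0r.
  exists (h (val x)); rewrite SE.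
  (* On [W] both words give the same point; elsewhere the weight is zero. *)
  have [[Wx _]|/h0 ->] := pselect ((W `&` U) (val x)); last by rewrite !scale0r.
  congr (_ *: Defs.basis _); apply: val_inj; exact: Wkl.
have [d dE] := choice SdE.
exists S, d; split=> //; last first.
  exists (wm gXX l x0); have := dE (wm gXX l x0); rewrite SE /h rk1 r1 rl1 !mul1r.
  rewrite (_ : wm gXX k x0 = wm gXX l x0) => [|]; last exact/val_inj/Wkl.
  move=> /(congr1 (fun v : l2 R XX => v (wm gXX l x0))).
  by rewrite !l2_scaleE basisE eqxx !mulr1.
have [_ _ closed_comp _] := star_subalgebra_generated
  (rhoA_hat_range R XX `|` rhoE_hat_range R g XX).
rewrite (_ : tensor _ _ = bop_comp Tk (bop_comp T0 Tl)).
  exact: (closed_comp _ _ ATk (closed_comp _ _ AT0 ATl)).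
apply: bop_ext => -[y i].
rewrite [RHS](_ : _ = Tk (T0 (Tl (Defs.basis (y, i)))))//.
have [[x _ <-]|Ny] := pselect (range (wm gXX l) y); last first.
  have Sy : S (Defs.basis y) = 0 *: Defs.basis y by rewrite S0// scale0r.
  by rewrite (Tl0 _ _ Ny) !linear0 (tensor_shift _ _ Sy) scale0r.
rewrite TlE (tensor_shift _ _ (SE x)) bopZ.
rewrite [T0 _](tensor_shift _ _ (rhoA_basis_val _ cr')) !bopZ TkE !scalerA.
rewrite !size_tuple; congr (_ *: Defs.basis (_, _)).
  by rewrite /h !rmorphM; ring.
by ring.
Qed.

End Representation.

(** * Proper containment and failure of maximality *)

Theorem theorem1p2p6 (R : realType) (X : topologicalType) (N : nat)
    (g : 'I_N -> X -> X) (XX : set X)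
    (compactX : compact [set: X])
    (hausdorffX : hausdorff_space X)
    (g_continuous : forall i, continuous (g i))
    (XX_dense : dense XX)
    (XX_invariant : completely_invariant g XX)
    (XX_disjoint : trivIset [set: 'I_N] (fun i => g i @` XX))
    (XX_injective : forall i, {in XX &, injective (g i)})
    (g_embedding : forall i, embedding (g i))
    (U_exists : exists U : set X,
       [/\ open U, dense U,
           trivIset [set: 'I_N] (fun i => g i @` U),
           forall i, open (g i @` U) /\ g i @` U `<=` U
         & XX `<=` U])
    (XX_comeager : comeager XX)
    (not_free : ~ essentially_free g) :
  rhoA_hat_range R XX `<` Dhat R g XX /\
  ~ is_masa (cstar_rho_hat R g XX) (rhoA_hat_range R XX).
Proof.
have [U [oU _ dU /all_and2[ogU gU] XXU]] := U_exists.
have gXX i : g i @` XX `<=` XX := (XX_invariant i).1.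
have [k [l [kl nowhere_kl]]] : exists k l, k <> l /\
    ~ nowhere_dense [set x | word_map g k x = word_map g l x].
  apply: contrapT => nex; apply: not_free => k l kl.
  by apply: contrapT => nd; apply: nex; exists k, l.
pose W := [set x | word_map g k x = word_map g l x]°.
have [x0 [Wx0 Xx0]] : W `&` XX !=set0.
  apply: XX_dense; last exact: open_interior.
  apply/set0P/eqP => W0; apply: nowhere_kl; rewrite /nowhere_dense.
  (* The coincidence set is closed, so an empty interior would already make it nowhere dense. *)
  rewrite -((closure_id _).1 _)//.
  by apply: closed_coincidence => //; exact: continuous_word.
have Wkl x : W x -> word_map g k x = word_map g l x by move=> /interior_subset.
have size_kl : size k <> size l.
  by move=> E; have [] := word_map_inj gXX XX_disjoint XX_injective E Xx0 Xx0 (Wkl _ Wx0).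
pose z0 : XX := exist _ x0 (mem_set Xx0).
have [S [d [ES AS SE [y dy]]]] := coincidence_operator (R := R) compactX
  hausdorffX g_continuous gXX XX_disjoint XX_injective oU dU ogU gU XXU
  (k := in_tuple k) (l := in_tuple l) (x0 := z0) (open_interior _) Wx0 Wkl.
set n : int := (size k)%:Z - (size l)%:Z in AS.
have DS : Dhat R g XX (tensor S (bishift R n)).
  apply/norm_closure_sub/lin_span_sub; exists n => //; exists S => //; split.
    by apply/norm_closure_sub/lin_span_sub; exists (size k), (size l).
  move=> u v uv; rewrite dot_basis SE l2_scaleE basisE.
  by case: eqP => [/uv//|_]; rewrite mulr0.
have NS : ~ rhoA_hat_range R XX (tensor S (bishift R n)).
  (* Coordinate [(y, n)] of the image of the basis vector at [(y, 0)] is 1 for the tensor but 0 for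
     [rhoA_hat], whose degree is 0 while [n] is not. *)
  move=> [a ca] /(congr1 (fun T : bop R (XX * int)%type =>
    T (Defs.basis (y, 0)) (y, n + 0))).
  rewrite /rhoA_hat (tensor_shift _ _ (SE y)).
  rewrite (tensor_shift _ _ (rhoA_basis_val compactX _ ca)).
  rewrite !l2_scaleE !basisE dy eqxx xpair_eqE eqxx !addr0 /=.
  rewrite [n == 0]negbTE ?mulr0 ?mulr1; last by rewrite subr_eq0; apply/eqP => -[].
  by move=> /eqP; rewrite eq_sym oner_eq0.
split.
  split; first exact: rhoA_hat_sub_Dhat.
  by move=> /(_ _ DS).
move=> [_ _ _ maximal]; apply: NS.
(* [is_masa] compares with star-subalgebras without asking for norm closure, so finite sums are
   admissible competitors. *)
rewrite -(maximal (cstar_rho_hat R g XX `&` shift_diagonal)).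
- by split=> //; exact: tensor_shift_diagonal SE.
- have [A0 Alin Acomp Aadj] := star_subalgebra_generated
    (rhoA_hat_range R XX `|` rhoE_hat_range R g XX).
  have [B0 Blin Bcomp Badj] := @shift_diagonal_star_subalgebra R XX.
  split=> // [a T T' [AT BT] [AT' BT']|T T' [AT BT] [AT' BT']|T T' [AT BT] TT'].
  + by split; [exact: Alin|exact: Blin].
  + by split; [exact: Acomp|exact: Bcomp].
  + by split; [exact: Aadj TT'|exact: Badj TT'].
- by move=> T T' [_ BT] [_ BT']; exact: shift_diagonal_commutative.
- exact: subIsetl.
- move=> T AT; split; first exact: rhoA_hat_sub_cstar.
  have [a ca <-] := AT.
  by apply: tensor_shift_diagonal => x; exact: rhoA_basis_val ca.
Qed.
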